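(* Let $G$ be a locally compact Polish group with left Haar measure $\mu$, let $X$ be a separable metrizable space, let $f:G\to X$ be a Haar measurable function and let $\mathbb{P}$ be a probability measure on $G$ equivalent to $\mu$ (i.e. with the same null sets). Define an $X$-valued stochastic field $(X_t)_{t\in G}$ on the probability space $(G,\mathbb{P})$ by $X_t(\omega):=f(\omega+t)$. Then the following alternative holds: either $(X_t)_{t\in G}$ is sample continuous, or for every non-null set $T\subset G$ the restricted field $(X_t)|_T$ does not have a natural modification.
   Context: The group $G$ is not assumed Abelian, but its operation is written additively. Haar measurable means measurable with respect to the completion of $\mu$. A set $T\subset G$ (not necessarily measurable) is non-null if its outer Haar measure is positive. $(X_t)|_T$ denotes $(X_t)_{t\in T}$, the restriction to the index set $T$. A modification of an $X$-valued field $(X_t)_{t\in T}$ on a probability space $\Omega$ is a map $\xi:\Omega\to X^T$ such that for each $t\in T$, $\xi(\omega)(t)=X_t(\omega)$ for almost every $\omega$. A modification $\xi$ is called natural if there exists a second countable topology $\mathcal{T}$ on the set $T$ such that for almost every $\omega\in\Omega$ the function $\xi(\omega):T\to X$ is $\mathcal{T}$-continuous. The field $(X_t)_{t\in G}$ is sample continuous if it has a modification $\xi$ such that for almost every $\omega$ the function $\xi(\omega):G\to X$ is continuous with respect to the given topology of $G$. *)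

(* Defs.v *)
From HB Require Import structures.
From mathcomp Require Import all_boot all_order all_algebra.
From mathcomp Require Import all_classical all_reals all_analysis.
From mathcomp Require Import measurable_realfun.

Set Implicit Arguments.
Unset Strict Implicit.
Unset Printing Implicit Defensive.

Import Order.TTheory GRing.Theory Num.Theory.

Local Open Scope ring_scope.
Local Open Scope classical_set_scope.
Local Open Scope ereal_scope.

(* Groups are not assumed commutative, hence they are [groupType]s, written
   multiplicatively: additive groups in MathComp ([zmodType]) are commutative. *)

HB.mixin Record isTopologicalGroup G & Topological G & Group G := {
  mulg_continuous : continuous (fun x : G * G => (x.1 * x.2)%g) ;
  invg_continuous : continuous (fun x : G => (x^-1)%g)
}.

(* [PointedTopological] because [g_sigma_algebraType] wants a pointed type; the
   distinguished point plays no role, a group being nonempty anyway. *)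
#[short(type="topologicalGroupType")]
HB.structure Definition TopologicalGroup :=
  {G of PointedTopological G & Group G & isTopologicalGroup G}.

Definition separable (T : topologicalType) :=
  exists2 D : set T, countable D & dense D.

Definition homeomorphic (S T : topologicalType) :=
  exists f : S -> T, exists g : T -> S,
    [/\ cancel f g, cancel g f, continuous f & continuous g].

Definition metrizable (R : realType) (T : topologicalType) :=
  exists M : metricType R, homeomorphic M T.

Definition complete_metric (R : realType) (M : metricType R) :=
  forall u : nat -> M, cauchy (u @ \oo) -> exists l : M, u @ \oo --> l.

Definition polish (R : realType) (T : topologicalType) :=
  separable T /\
  exists M : metricType R, complete_metric M /\ homeomorphic M T.

Notation borelType G := (g_sigma_algebraType (@open G)).

Section haar.
Context (R : realType) (G : topologicalGroupType).
Variable mu : {measure set (borelType G) -> \bar R}.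

Definition radon :=
  [/\ forall K : set G, compact K -> mu K < +oo,
      forall A : set (borelType G), measurable A ->
        mu A = ereal_inf [set mu U | U in [set U : set G | open U /\ A `<=` U]]
    & forall U : set G, open U ->
        mu U = ereal_sup [set mu K | K in [set K : set G | compact K /\ K `<=` U]]].

Definition left_invariant :=
  forall (g : G) (A : set (borelType G)), measurable A ->
    mu [set (g * x)%g | x in (A : set G)] = mu A.

Definition left_haar_measure :=
  [/\ radon, left_invariant & mu [set: G] != 0].

(* [completed_algebra_gen mu] consists of the sets A `|` N with A Borel and N
   mu-negligible; on a sigma-algebra this is the whole completion of the latter
   with respect to mu, not just a generator. *)
Definition haar_measurable_fun (X : topologicalType) (f : G -> X) :=
  forall B : set X, <<s @open X >> B -> completed_algebra_gen mu (f @^-1` B).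

(* Outer measure, as T need not be measurable. *)
Definition non_null (T : set G) := 0 < (mu^*)%mu (T : set (borelType G)).

End haar.

Section fields.
Context d (Omega : measurableType d) (R : realType) (P : probability Omega R).

Definition modification (I X : Type) (F : I -> Omega -> X)
    (xi : Omega -> I -> X) :=
  forall t : I, {ae P, forall w, xi w t = F t w}.

(* The topology in question is an arbitrary one on the bare index set I, given
   as a [Topological] class on I; it is unrelated to any topology I may carry. *)
Definition natural_modification (I : Type) (X : topologicalType)
    (F : I -> Omega -> X) (xi : Omega -> I -> X) :=
  modification F xi /\
  exists tau : Topological I, let I_tau := Topological.Pack tau in
    @second_countable I_tau /\ {ae P, forall w, continuous (xi w : I_tau -> X)}.

Definition sample_continuous (G X : topologicalType) (F : G -> Omega -> X) :=
  exists2 xi : Omega -> G -> X,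
    modification F xi & {ae P, forall w, continuous (xi w)}.

End fields.

Definition restrict_field (I Omega X : Type) (F : I -> Omega -> X) (T : set I) :
    T -> Omega -> X :=
  fun t => F (set_val t).

Definition translation_field (G : topologicalGroupType) (X : Type) (f : G -> X) :
    G -> borelType G -> X :=
  fun t w => f ((w : G) * t)%g.

(* Main.v *)
(* Suppose that xi is a natural modification of the field on a non-null set T,
   for a topology on T with countable base BI, and let BX be a countable base of
   X.  By continuity of the paths, for almost every w and every t in T there are
   arbitrarily small W in BX and some U in BI containing t such that w lies in
   the Borel set A U W of the points w whose path sends a dense sequence of U
   into W.  Let B U W be the Borel set of the s such that f (w s) lies in the
   closure of W for almost every w in A U W; it contains U.  By Fubini's theorem
   and left invariance, f y lies in the closure of W for almost every y such
   that A U W meets y (B U W)^-1 in a set of positive measure, and by a Steinhaus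
   argument the set of these y is open.  Every x factors as w t with t in T and
   w outside any prescribed null set, as inversion and right translations
   preserve null sets; hence x belongs to these open sets for arbitrarily small
   neighbourhoods W of xi w t, and f has an essential limit at x.  The
   essential limits form a continuous function g equal to f almost everywhere,
   and g (w t) is the required sample continuous modification. *)

Require Import Defs.
From HB Require Import structures.
From mathcomp Require Import all_boot all_order all_algebra.
From mathcomp Require Import all_classical all_reals all_analysis.
From mathcomp Require Import measurable_realfun.
From mathcomp Require Import lra.

Set Implicit Arguments.
Unset Strict Implicit.
Unset Printing Implicit Defensive.

Import Order.TTheory GRing.Theory Num.Theory.

Local Open Scope ring_scope.
Local Open Scope classical_set_scope.
Local Open Scope ereal_scope.

(** * Separation properties and countable bases *)

Lemma homeomorphic_hausdorff (S T : topologicalType) :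
  homeomorphic S T -> hausdorff_space S -> hausdorff_space T.
Proof.
move=> [f [g [_ gK _ cg]]] hS p q clpq; apply: (can_inj gK); apply: hS.
move=> A B /cg nA /cg nB; have [x [Ax Bx]] := clpq _ _ nA nB.
by exists (g x).
Qed.

Lemma homeomorphic_regular (S T : topologicalType) :
  homeomorphic S T -> regular_space S -> regular_space T.
Proof.
move=> [f [g [fK gK cf cg]]] rS x O nO.
have : nbhs (g x) (f @^-1` O) by apply: cf; rewrite /= gK.
move=> /rS [V nV VO]; exists (g @^-1` V); first exact: cg.
move=> y cly; rewrite -[y]gK; apply: VO => A nA.
by have [z [Vz Az]] := cly _ (cg y _ nA); exists (g z).
Qed.

Lemma separable_metrizable_second_countable (R : realType)
    (T : topologicalType) :
  separable T -> metrizable R T -> @second_countable T.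
Proof.
move=> [D cD dD] [M [g [f [gK fK cg cf]]]].
pose base (p : T * nat) : set T :=
  f @^-1` (ball (f p.1) (p.2.+1%:R^-1 : R)%R)°.
exists (base @` (D `*` setT)).
  by apply: sub_countable (card_image_le _ _) _; apply: countableX.
split=> [_ [p _ <-]|x O nO].
  by apply: open_comp => [y _|]; [exact: cf | exact: open_interior].
have : nbhs (f x) (g @^-1` O) by apply: cg; rewrite /= fK.
move=> /nbhs_ballP[e /= e0 eO].
(* Write r for 1/(n+1) < e/2, and take a dense point [a] within r/2 of x. Then the ball of radius
   r/2 about x lies in the r-ball about [a], so x is interior to the latter, which in turn lies in
   the e-ball about x. *)
have [n ne] : exists n : nat, (n.+1%:R^-1 < e / 2 :> R)%R.
  by have [n] := ltr_add_invr (divr_gt0 e0 (ltr0Sn R 1)); rewrite add0r;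
    exists n.
have n0 : (0 < (n.+1%:R^-1 : R) / 2)%R by rewrite divr_gt0// invr_gt0.
have [a [/= fxa Da]] :
    (f @^-1` (ball (f x) (n.+1%:R^-1 / 2 : R)%R)° `&` D) !=set0.
  apply: dD; last first.
    by apply: open_comp => [y _|]; [exact: cf | exact: open_interior].
  by exists x; exact: (nbhsx_ballx _ _ n0).
have {}fxa := interior_subset fxa.
exists (base (a, n)).
  split; first by exists (a, n).
  rewrite /base /=; apply/nbhs_ballP; exists (n.+1%:R^-1 / 2)%R => //= z xz.
  rewrite [X in ball _ X](splitr (n.+1%:R^-1 : R)%R).
  exact: ball_triangle (ball_sym fxa) xz.
move=> y /= /interior_subset ay; rewrite -[y]fK; apply: eO.
rewrite [X in ball _ X](splitr e); apply: (@ball_triangle _ _ (f a)).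
  apply: le_ball fxa; apply: ltW; apply: le_lt_trans ne.
  by rewrite ler_pdivrMr// ler_peMr// ler1n.
by apply: le_ball ay; exact: ltW.
Qed.

(** * Almost everywhere statements, Fubini, and Borel sets of products *)

Lemma bigcup_countable_measurable d (T : measurableType d) (I : Type)
    (D : set I) (F : I -> set T) :
  countable D -> (forall i, D i -> measurable (F i)) ->
  measurable (\bigcup_(i in D) F i).
Proof.
move=> cD mF; rewrite bigcup_set_type.
apply: countable_bigcupT_measurable => [|[i Di]]; last exact/mF/set_mem.
by apply: sub_countable cD; have /card_eqPle[] := card_setT D.
Qed.

Lemma ae_countable d (T : measurableType d) (R : realType)
    (mu : {measure set T -> \bar R}) (I : Type) (D : set I)
    (Q : I -> T -> Prop) :
  countable D -> (forall i, D i -> {ae mu, forall x, Q i x}) ->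
  {ae mu, forall x, forall i, D i -> Q i x}.
Proof.
move=> /countable_injP[k kinj] DQ.
suff : {ae mu, forall x, forall n i, D i -> k i = n -> Q i x}.
  by apply: filterS => x H i Di; exact: (H (k i)).
apply: ae_foralln => n.
have [[i [Di kin]]|no] := pselect (exists i, D i /\ k i = n).
  apply: filterS (DQ _ Di) => x Qx j Dj kjn.
  by rewrite (kinj j i) ?inE// kjn.
by apply: aeW => x i Di kin; case: no; exists i.
Qed.

(** A Lindelöf argument: the basic open sets on which [Q] holds almost everywhere are countably many
    and cover [A], so their exceptional sets have a null union. *)
Lemma ae_local (R : realType) (G : ptopologicalType)
    (mu : {measure set (borelType G) -> \bar R}) (A Q : set G) :
  @second_countable G ->
  (forall x, A x ->
     exists2 V, nbhs x V & {ae mu, forall z : borelType G, V z -> Q z}) ->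
  {ae mu, forall z : borelType G, A z -> Q z}.
Proof.
have aeF := ae_filter_ringOfSetsType mu.
move=> [B cB [Bo Bb]] AQ.
have : {ae mu, forall z : borelType G, forall U,
    (B `&` [set U | {ae mu, forall z : borelType G, U z -> Q z}]) U ->
    U z -> Q z}.
  apply: ae_countable => [|U []//]; exact: sub_countable (subset_card_le _) cB.
apply: filterS => z Hz Az; have [V nV VQ] := AQ z Az.
have [U [BU Uz] UV] := Bb z V nV.
apply: (Hz U) => //; split => //.
by apply: filterS VQ => y Vy /UV.
Qed.

Lemma ae_fubini d1 d2 (T1 : measurableType d1) (T2 : measurableType d2)
    (R : realType) (m1 : {sigma_finite_measure set T1 -> \bar R})
    (m2 : {sigma_finite_measure set T2 -> \bar R}) (E : set (T1 * T2)) :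
  measurable E ->
  {ae m1, forall x, {ae m2, forall y, E (x, y)}} ->
  {ae m2, forall y, {ae m1, forall x, E (x, y)}}.
Proof.
move=> mE H.
have mC := measurableC mE.
have xs x : {ae m2, forall y, E (x, y)} <-> m2 (xsection (~` E) x) = 0.
  rewrite -negligibleP; last exact: measurable_xsection.
  suff -> : xsection (~` E) x = ~` [set y | E (x, y)] by [].
  by apply/seteqP; split=> y; rewrite /xsection /= inE.
have ys y : {ae m1, forall x, E (x, y)} <-> m1 (ysection (~` E) y) = 0.
  rewrite -negligibleP; last exact: measurable_ysection.
  suff -> : ysection (~` E) y = ~` [set x | E (x, y)] by [].
  by apply/seteqP; split=> x; rewrite /ysection /= inE.
have := indic_fubini_tonelli m1 m2 mC.
rewrite indic_fubini_tonelli_FE// indic_fubini_tonelli_GE//.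
have mx := measurable_fun_xsection m2 mC.
have my := measurable_fun_ysection m1 mC.
have -> : \int[m1]_x (m2 \o xsection (~` E)) x
    = \int[m1]_x `|(m2 \o xsection (~` E)) x|.
  by apply: eq_integral => x _; rewrite gee0_abs.
have -> : \int[m2]_y (m1 \o ysection (~` E)) y
    = \int[m2]_y `|(m1 \o ysection (~` E)) y|.
  by apply: eq_integral => y _; rewrite gee0_abs.
have -> : \int[m1]_x `|(m2 \o xsection (~` E)) x| = 0.
  apply/(ae_eq_integral_abs m1 measurableT mx).
  by apply: filterS H => x /xs Hx _.
move=> /esym /(ae_eq_integral_abs m2 measurableT my).
by apply: filterS => y /(_ I) /ys.
Qed.

(** With countable bases an open set is a countable union of open rectangles; hence continuous maps
    on the product are measurable for the product sigma-algebra, as Fubini requires. *)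
Lemma open_measurable_prod (S T : ptopologicalType) (O : set (S * T)) :
  @second_countable S -> @second_countable T -> open O ->
  measurable (O : set (borelType S * borelType T)).
Proof.
move=> [B cB [Bo Bb]] [C cC [Co Cb]] oO.
pose I := [set UV : set S * set T | (B `*` C) UV /\ UV.1 `*` UV.2 `<=` O].
have -> : O = \bigcup_(UV in I) (UV.1 `*` UV.2).
  apply/seteqP; split=> [[s t] Ost|p [UV [_ UVO] ?]]; last exact: UVO.
  have /= [[U V] [/= /Bb[U' [BU' U's] UU'] /Cb[V' [CV' V't] VV']] UVO] :
    nbhs (s, t) O by exact: open_nbhs_nbhs.
  by exists (U', V') => //; split=> // -[x y] /= [/UU' ? /VV' ?]; exact: UVO.
apply: bigcup_countable_measurable => [|[U V] [[/Bo oU /Co oV] _]].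
  by apply: sub_countable (countableX cB cC); apply: subset_card_le => UV [].
by apply: measurableX; exact: sub_sigma_algebra.
Qed.

Lemma continuous_borel_measurable (S T : ptopologicalType) (h : S -> T) :
  continuous h -> measurable_fun setT (h : borelType S -> borelType T).
Proof.
move=> ch; apply: (@measurability _ _ (borelType S) (borelType T)
  setT h (@open T)) => // _ [V oV <-].
by rewrite setTI; apply: sub_sigma_algebra; apply: open_comp.
Qed.

Lemma continuous_borel_measurable2 (S T U : ptopologicalType)
    (h : S * T -> U) :
  @second_countable S -> @second_countable T -> continuous h ->
  measurable_fun setT (h : borelType S * borelType T -> borelType U).
Proof.
move=> sS sT ch; apply: (@measurability _ _
  (borelType S * borelType T)%type (borelType U) setT h (@open U)) => // _ [V oV <-].
by rewrite setTI; apply: open_measurable_prod => //; apply: open_comp.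
Qed.

Lemma null_dominates_ae d (T : measurableType d) (R : realType)
    (m1 m2 : {measure set T -> \bar R}) (Q : T -> Prop) :
  m1 `<< m2 -> {ae m2, forall x, Q x} -> {ae m1, forall x, Q x}.
Proof.
move=> /null_content_dominatesP m12 [A [mA A0 QA]].
by exists A; split => //; exact: m12.
Qed.

Lemma continuous_mulg_comp (G : topologicalGroupType)
    (T : topologicalType) (h k : T -> G) :
  continuous h -> continuous k -> continuous (fun x => (h x * k x)%g).
Proof.
move=> ch ck x; apply: (@continuous_comp _ _ _ (fun x => (h x, k x))
  (fun p : G * G => (p.1 * p.2)%g)); last exact: mulg_continuous.
by apply: cvg_pair; [exact: ch|exact: ck].
Qed.

Lemma continuous_invg_comp (G : topologicalGroupType)
    (T : topologicalType) (h : T -> G) :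
  continuous h -> continuous (fun x => (h x)^-1%g).
Proof.
move=> ch x; apply: (@continuous_comp _ _ _ h (fun p : G => p^-1%g)).
  exact: ch.
exact: invg_continuous.
Qed.

(** * Invariance of null sets under translations and inversion *)

Section haar_measure.
Context (R : realType) (G : topologicalGroupType).
Context (mu : {measure set (borelType G) -> \bar R}).
Context (P : probability (borelType G) R).
Context (scG : @second_countable G) (muL : left_invariant mu).
Context (P_mu : P `<< mu) (mu_P : mu `<< P).
Implicit Types (g : G) (Q : borelType G -> Prop).

Lemma ae_mulgl g Q : {ae mu, forall x, Q x} ->
  {ae mu, forall x : borelType G, Q (g * x)%g}.
Proof.
move=> [A [mA A0 QA]].
exists [set (g^-1 * x)%g | x in (A : set G)]; split.
- have -> : [set (g^-1 * x)%g | x in (A : set G)] =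
      (fun x : G => g * x)%g @^-1` A.
    apply/seteqP; split=> [_ [x Ax <-]|x Ax] /=; first by rewrite mulVKg.
    by exists (g * x)%g => //; rewrite mulKg.
  rewrite -[X in measurable X]setTI.
  apply: (@continuous_borel_measurable G G (fun x : G => g * x)%g) => //.
  by apply: continuous_mulg_comp => x; [exact: cvg_cst|exact: cvg_id].
- by rewrite muL.
- by move=> x /= nQ; exists (g * x)%g; [exact: QA|rewrite mulKg].
Qed.

(** For each x, almost every y has x^-1 y outside the null set [A]. Fubini yields a single y such
    that this holds for almost every x, and replacing x by y x turns x^-1 y into x^-1. Fubini is
    applied to [P], which is finite and has the same null sets as [mu]. *)
Lemma ae_invg Q : {ae mu, forall x, Q x} ->
  {ae mu, forall x : borelType G, Q (x^-1)%g}.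
Proof.
move=> [A [mA A0 QA]].
pose E : set (borelType G * borelType G) := [set p | ~ A (p.1^-1 * p.2)%g].
have mE : measurable E.
  pose h (p : G * G) := (p.1^-1 * p.2)%g.
  have ch : continuous h.
    apply: continuous_mulg_comp => x; last exact: cvg_snd.
    by apply: continuous_invg_comp => {}x; exact: cvg_fst.
  rewrite -[E]setTI.
  exact: (continuous_borel_measurable2 scG scG ch measurableT (measurableC mA)).
have nA : {ae mu, forall x, ~ A x} by exists A; split => // x /= /contrapT.
have : {ae P, forall y, {ae P, forall x, E (x, y)}}.
  apply: (@ae_fubini _ _ _ _ _ P P) => //; apply: aeW => x.
  by apply: null_dominates_ae P_mu _; exact: (@ae_mulgl x^-1%g _ nA).
have PT : 0 < P setT by rewrite probability_setT lte01.
have PF := ae_properfilter_algebraOfSetsType PT.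
move=> /filter_ex[y /(null_dominates_ae mu_P)/(ae_mulgl y)].
apply: filterS => x; rewrite /E /= invgM -mulgA mulVg mulg1 => nAx.
by apply: contrapT => /QA.
Qed.

Lemma ae_mulgr g Q : {ae mu, forall x, Q x} ->
  {ae mu, forall x : borelType G, Q (x * g)%g}.
Proof.
move=> /ae_invg /(ae_mulgl g^-1%g) /ae_invg.
by apply: filterS => x; rewrite invgM !invgK.
Qed.

(** * The Steinhaus argument *)

Context (hsG : hausdorff_space G) (lcG : locally_compact [set: G]).
Context (muR : radon mu).

Lemma compact_borel_measurable (K : set G) :
  compact K -> measurable (K : set (borelType G)).
Proof.
move=> /(compact_closed hsG) /closed_openC cK; rewrite -[K]setCK.
by apply: measurableC; exact: sub_sigma_algebra.
Qed.

(** Every point has a compact neighbourhood, of finite measure; if [C] met all of these in null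
    sets, it would be null by [ae_local]. *)
Lemma non_negligible_finite_part (C : set (borelType G)) :
  measurable C -> ~ mu.-negligible C ->
  exists D, [/\ measurable D, D `<=` C, 0 < mu D & mu D < +oo].
Proof.
move=> mC nC; apply: contrapT => noD; apply: nC.
have : {ae mu, forall z : borelType G, setT z -> (~` C) z}.
  apply: ae_local scG _ => x _.
  have [V nV [cV _]] := lcG (I : setT x).
  exists V; first by move: nV; rewrite withinET.
  have mV := compact_borel_measurable cV.
  have mD : measurable (C `&` V) by exact: measurableI.
  exists (C `&` V); split => //.
    apply/eqP; rewrite -measure_le0 leNgt; apply/negP => D0.
    apply: noD; exists (C `&` V); split => //.
    apply: le_lt_trans (_ : mu V < _); last by case: muR => + _ _; apply.
    by apply: le_measure; rewrite ?inE.
  by move=> z /= /not_implyP[Vz /contrapT].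
by apply: negligibleS => z Cz /= /(_ I).
Qed.

(* Outer and inner regularity give a compact K and an open U containing K with
   mu U < 3/2 mu (C `&` K); as g K stays inside U for g near 1, C `&` K and its
   translate by g are too large to be disjoint. *)
Lemma near_translate_nonnull (C : set (borelType G)) :
  measurable C -> ~ mu.-negligible C ->
  \forall g \near (1%g : G),
    ~ mu.-negligible (C `&` [set w : borelType G | C (g^-1 * w)%g]).
Proof.
move=> mC /(non_negligible_finite_part mC)[D [mD DC D0 Doo]].
have [_ outer inner] := muR.
have Dfin : mu D \is a fin_num by rewrite ge0_fin_numE// ltW.
set r := fine (mu D).
have Dr : mu D = r%:E by rewrite fineK.
have r0 : (0 < r)%R by rewrite -lte_fin -Dr.
(* The margins r/4 give mu U < 5r/4 and mu (U \ K) < r/4, so [D]&[K] has measure above 3r/4. Two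
   copies of it in U with null intersection would need more than 3r/2. *)
have [_ [U [oU DU] <-] Ur] : exists2 y,
    [set mu U | U in [set U : set G | open U /\ D `<=` U]] y &
    y < (r + r / 4)%:E.
  apply: ereal_inf_lt; rewrite -outer// Dr lte_fin; lra.
have mU : measurable (U : set (borelType G)) by exact: sub_sigma_algebra.
have Ufin : mu U \is a fin_num by rewrite ge0_fin_numE// (lt_trans Ur)// ltry.
set u := fine (mu U); have Uu : mu U = u%:E by rewrite fineK.
have [_ [K [cK KU] <-] uK] : exists2 y,
    [set mu K | K in [set K : set G | compact K /\ K `<=` U]] y &
    (u - r / 4)%:E < y.
  apply: ereal_sup_gt; rewrite -inner// Uu lte_fin; lra.
have mK := compact_borel_measurable cK.
set C2 : set (borelType G) := D `&` K.
have mC2 : measurable C2 by exact: measurableI.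
have C2U : C2 `<=` U by move=> z [_ /KU].
have C2fin : mu C2 \is a fin_num.
  by rewrite ge0_fin_numE// (le_lt_trans _ Doo)// le_measure ?inE// => z [].
have C2big : (r - r / 4)%:E < mu C2.
  have DC2 : mu D <= mu C2 + mu (U `\` K).
    apply: le_trans (measureU2 mu mC2 (measurableD mU mK)).
    apply: le_measure; rewrite ?inE//.
      by apply: measurableU => //; exact: measurableD.
    move=> z Dz; have [Kz|nKz] := pselect (K z); [by left|right].
    by split => //; exact: DU.
  have : mu U = mu (U `\` K) + mu (U `&` K) := measureDI mu mU mK.
  have -> : (U `&` K : set (borelType G)) = K by apply/setIidPr.
  have UKfin : mu (U `\` K) \is a fin_num.
    rewrite ge0_fin_numE// (le_lt_trans (_ : _ <= mu U)) ?le_measure ?inE//.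
    - exact: measurableD.
    - by rewrite -ge0_fin_numE.
  have Kfin : mu K \is a fin_num.
    rewrite ge0_fin_numE// (le_lt_trans (_ : _ <= mu U)) ?le_measure ?inE//.
    by rewrite -ge0_fin_numE.
  move: DC2 uK; rewrite Uu Dr -(fineK UKfin) -(fineK Kfin) -(fineK C2fin).
  rewrite -!EFinD !lte_fin lee_fin => DC2 uK [] UKE; lra.
have : \forall g \near (1%g : G), K `<=` [set k | U (g * k)%g].
  move/compact_near_coveringP : cK; apply => k Kk.
  have cm : continuous (fun p : G * G => p.2 * p.1)%g.
    by apply: continuous_mulg_comp => p; [exact: cvg_snd|exact: cvg_fst].
  apply: (cm (k, 1%g)); rewrite /= mul1g; apply: open_nbhs_nbhs; split => //.
  exact: KU.
apply: filterS => g gK nCg.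
pose gC2 : set (borelType G) := [set w : G | C2 (g^-1 * w)%g].
have gC2E : gC2 = [set (g * x)%g | x in (C2 : set G)].
  apply/seteqP; split=> [w C2w|_ [x C2x <-]]; last by rewrite /gC2 /= mulKg.
  by exists (g^-1 * w)%g => //; rewrite mulVKg.
have mgC2 : measurable gC2.
  have ch : continuous (fun w : G => g^-1 * w)%g.
    by apply: continuous_mulg_comp => w; [exact: cvg_cst|exact: cvg_id].
  by rewrite -[X in measurable X]setTI; exact: (continuous_borel_measurable ch).
have mI := measurableI _ _ mgC2 mC2.
have mD2 := measurableD mgC2 mC2.
have I0 : mu (gC2 `&` C2) = 0.
  apply: measure_negligible => //; apply: negligibleS nCg.
  by move=> w [[/DC Cgw _] [/DC Cw _]].
have : mu (C2 `|` (gC2 `\` C2)) <= mu U.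
  apply: le_measure; rewrite ?inE//; first exact: measurableU.
  move=> w [/C2U//|[[_ /gK /=]]]; by rewrite mulVKg.
have -> : mu (C2 `|` (gC2 `\` C2)) = mu C2 + mu (gC2 `\` C2).
  by apply: measureU => //; rewrite setIC setDKI.
have : mu gC2 = mu (gC2 `\` C2) + mu (gC2 `&` C2) := measureDI mu mgC2 mC2.
rewrite I0 adde0 => <-.
rewrite gC2E muL//; move: C2big Ur; rewrite Uu -(fineK C2fin).
rewrite -!EFinD !lte_fin lee_fin => h1 h2 h3.
clear -r0 h1 h2 h3; lra.
Qed.

(** Let C be the set attached to x and g = y x^-1. If w lies in both C and g C, then w is in [A] and
    (g^-1 w)^-1 x = w^-1 y is in [B]; so the set attached to y contains the intersection of C and g
    C, which is non-null for y near x. *)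
Lemma open_nonnull_translate (A B : set (borelType G)) :
  measurable A -> measurable B ->
  open [set y : G | ~ mu.-negligible
    (A `&` [set w : borelType G | B ((w : G)^-1 * y)%g])].
Proof.
move=> mA mB.
suff nbhs_open (W : set G) : (forall x, W x -> nbhs x W) -> open W.
  apply: nbhs_open => x /= nC.
  have mC : measurable (A `&` [set w : borelType G | B ((w : G)^-1 * x)%g]).
    apply: measurableI => //.
    have ch : continuous (fun w : G => w^-1 * x)%g.
      apply: continuous_mulg_comp => w; last exact: cvg_cst.
      by apply: continuous_invg_comp => {}w; exact: cvg_id.
    rewrite -[X in measurable X]setTI.
    exact: (continuous_borel_measurable ch).
  have cx : continuous (fun y : G => y * x^-1)%g.
    by apply: continuous_mulg_comp => w; [exact: cvg_id|exact: cvg_cst].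
  have := cx x; rewrite /continuous_at mulgV.
  move=> /(_ _ (near_translate_nonnull mC nC)).
  rewrite nbhs_simpl /=; apply: filterS => y /= H1 H2; apply: H1.
  apply: negligibleS H2 => w [[Aw _] [_ /=]].
  by rewrite !invgM !invgK !mulgA mulgVK => ?; split.
by rewrite openE.
Qed.

(** * Continuous representatives from essential limits *)

Context (mu_neq0 : mu [set: G] != 0).

(** Otherwise [V] would be null, hence so would its left translates, which include a neighbourhood
    of every point; then G itself would be null. *)
Lemma ae_dense (V : set G) (x : G) Q :
  nbhs x V -> {ae mu, forall z, Q z} -> exists z : G, V z /\ Q z.
Proof.
move=> nV aeQ; apply: contrapT => noz.
have aeF := ae_filter_ringOfSetsType mu.
have nVae : {ae mu, forall z : borelType G, ~ V z}.
  by apply: filterS aeQ => z Qz Vz; apply: noz; exists z.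
have : {ae mu, forall z : borelType G, setT z -> False}.
  apply: ae_local scG _ => y _.
  exists [set z | V (x * y^-1 * z)%g].
    have c : continuous (fun z : G => x * y^-1 * z)%g.
      by apply: continuous_mulg_comp => z; [exact: cvg_cst|exact: cvg_id].
    by apply: (c y); rewrite /= mulgVK.
  exact: (@ae_mulgl (x * y^-1)%g _ nVae).
have muT : 0 < mu setT by rewrite lt0e mu_neq0 measure_ge0.
have PF := ae_properfilter_algebraOfSetsType muT.
by move=> /filter_ex[z /(_ I)].
Qed.

(** If f is almost everywhere in N on V, the essential limits at interior points of V lie in the
    closure of N, so regularity gives continuity of g. Moreover, for almost every z, f z lies in
    every basic neighbourhood of g z, and the Hausdorff property gives f z = g z. *)
Lemma continuous_ae_representative (X : topologicalType) (f : G -> X) :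
  @second_countable X -> hausdorff_space X -> regular_space X ->
  (forall x : G, exists y : X, forall O : set X, nbhs y O ->
     exists2 V, nbhs x V & {ae mu, forall z : borelType G, V z -> O (f z)}) ->
  exists2 g : G -> X, continuous g & {ae mu, forall z : borelType G, g z = f z}.
Proof.
move=> [B cB [Bo Bb]] hX rX /choice[g gf].
have aeF := ae_filter_ringOfSetsType mu.
exists g.
  move=> x O /rX[N nN clN]; have [V nV VN] := gf x N nN.
  apply: filterS (nbhs_interior nV) => x' V'x'; apply: clN => A nA.
  have [V1 nV1 V1A] := gf x' A nA.
  have [z [[Vz V1z] [Nz Az]]] := ae_dense (filterI V'x' nV1) (filterI VN V1A).
  by exists (f z); split; [exact: Nz|exact: Az].
have : {ae mu, forall z : borelType G, forall W, B W -> W (g z) -> W (f z)}.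
  apply: ae_countable cB _ => W BW.
  apply: (@ae_local _ _ _ (g @^-1` W) (f @^-1` W) scG) => x Wx.
  by apply: gf; apply: open_nbhs_nbhs; split => //; exact: Bo.
apply: filterS => z Wz; apply: hX => A A' nA nA'.
have [W [BW Wgz] WA] := Bb _ _ nA.
by exists (f z); split; [apply: WA; exact: Wz|exact: nbhs_singleton].
Qed.

(** * Essential limits from a natural modification *)

(** Fubini puts w first; for fixed w the substitution s = w^-1 y preserves null sets and turns w s
    into y; Fubini then puts y first. For almost every y, a non-null set of w satisfying both
    premises leaves one that yields [C y]. *)
Lemma ae_of_translates (A B C : set (borelType G)) :
  measurable A -> measurable B -> measurable C ->
  (forall s, B s ->
     {ae mu, forall w : borelType G, A w -> C ((w : G) * s)%g}) ->
  {ae mu, forall y : borelType G,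
    ~ mu.-negligible (A `&` [set w : borelType G | B ((w : G)^-1 * y)%g]) ->
    C y}.
Proof.
move=> mA mB mC ABC.
have aeF := ae_filter_ringOfSetsType mu.
have aePF := ae_filter_ringOfSetsType P.
have PmuE Q := @null_dominates_ae _ _ _ P mu Q P_mu.
have muPE Q := @null_dominates_ae _ _ _ mu P Q mu_P.
have cfst : continuous (@fst G G) by move=> p; exact: cvg_fst.
have csnd : continuous (@snd G G) by move=> p; exact: cvg_snd.
have mpre (h : G * G -> G) (D : set (borelType G)) :
    continuous h -> measurable D ->
    measurable (h @^-1` D : set (borelType G * borelType G)).
  move=> ch mD; rewrite -[X in measurable X]setTI.
  exact: (continuous_borel_measurable2 scG scG ch).
pose E1 : set (borelType G * borelType G) :=
  [set p | A p.2 -> B p.1 -> C ((p.2 : G) * p.1)%g].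
pose E2 : set (borelType G * borelType G) :=
  [set p | A p.1 -> B ((p.1 : G)^-1 * p.2)%g -> C p.2].
have imp3 (D1 D2 D3 : set (borelType G * borelType G)) :
    measurable D1 -> measurable D2 -> measurable D3 ->
    measurable [set p | D1 p -> D2 p -> D3 p].
  move=> m1 m2 m3.
  have -> : [set p | D1 p -> D2 p -> D3 p] = ~` D1 `|` (~` D2 `|` D3).
    apply/seteqP; split=> p /=; last by case=> [?|[?|?]].
    have [D1p|] := pselect (D1 p); last by left.
    by have [D2p|] := pselect (D2 p); right; [right; auto|left].
  by apply: measurableU; [|apply: measurableU => //]; exact: measurableC.
have mE1 : measurable E1.
  apply: (imp3 (snd @^-1` A) (fst @^-1` B)
      ((fun p : G * G => p.2 * p.1)%g @^-1` C));
    apply: mpre => //; exact: continuous_mulg_comp.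
have mE2 : measurable E2.
  apply: (imp3 (fst @^-1` A)
      ((fun p : G * G => p.1^-1 * p.2)%g @^-1` B) (snd @^-1` C));
    apply: mpre => //; apply: continuous_mulg_comp => //;
    exact: continuous_invg_comp.
have H1 : {ae P, forall w, {ae P, forall s, E1 (s, w)}}.
  apply: (@ae_fubini _ _ _ _ _ P P) => //; apply: aeW => s.
  have [Bs|nBs] := pselect (B s).
    by apply: filterS (PmuE _ (ABC s Bs)) => w wAC Aw _; exact: wAC.
  by apply: aeW => w _ /nBs.
have H2 : {ae P, forall w, {ae P, forall y, E2 (w, y)}}.
  apply: filterS H1 => w /muPE /(@ae_mulgl (monoid.inv (w : G)) _) /PmuE.
  by apply: filterS => y; rewrite /E1 /E2 /= mulVKg => H ? ?; exact: H.
have := ae_fubini (m1 := P) (m2 := P) mE2 H2.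
move=> /muPE; apply: filterS => y /muPE E2y nN.
apply: contrapT => nC; apply: nN; apply: negligibleS E2y => w [Aw Bw] /= H.
exact/nC/H.
Qed.

Lemma completed_algebra_genP (S : set G) : completed_algebra_gen mu S ->
  exists2 Q : set (borelType G), measurable Q &
    {ae mu, forall x : borelType G, S x <-> Q x}.
Proof.
move=> [A mA [N nN <-]]; exists A => //; refine (negligibleS _ nN) => x /= H.
by apply: contrapT => nNx; apply: H; split=> [[]//|]; left.
Qed.

(** The index space is a separate [I] with a bare map [j] into G, since its topology need not be
    related to that of G. *)
Lemma essential_limit (I X : topologicalType) (j : I -> G) (f : G -> X)
    (xi : borelType G -> I -> X) :
  @second_countable I -> @second_countable X -> regular_space X ->
  haar_measurable_fun mu f -> ~ mu.-negligible (range j : set (borelType G)) ->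
  (forall i, {ae mu, forall w : borelType G, xi w i = f (w * j i)%g}) ->
  {ae mu, forall w, continuous (xi w)} ->
  forall x : G, exists y : X, forall O : set X, nbhs y O ->
    exists2 V, nbhs x V & {ae mu, forall z : borelType G, V z -> O (f z)}.
Proof.
move=> [BI cBI [BIo BIb]] [BX cBX [BXo BXb]] rX mf nj xif cxi x.
have aeF := ae_filter_ringOfSetsType mu.
(* [d] will pick a point in each nonempty set, so that its values on the base [BI] include a
   countable dense set; [i0] is its default on the empty set. *)
have [i0 _] : exists i : I, True.
  apply: contrapT => noi; apply: nj; rewrite (_ : range j = set0).
    exact: negligible_set0.
  by apply/seteqP; split=> // y [i _ _]; case: noi; exists i.
have /choice[d dU] (U : set I) : exists s, U !=set0 -> U s.
  by have [[s Us]|nU] := pselect (U !=set0); [exists s|exists i0].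
have /choice[Q QP] (W : set X) : exists Q : set (borelType G), open W ->
    measurable Q /\ {ae mu, forall z : borelType G, W (f z) <-> Q z}.
  have [oW|nW] := pselect (open W); last by exists set0.
  have [Q mQ QE] := completed_algebra_genP (mf W (sub_sigma_algebra oW)).
  by exists Q.
have /choice[C CP] (W : set X) : exists C : set (borelType G),
    measurable C /\ {ae mu, forall z : borelType G, closure W (f z) <-> C z}.
  have [|C mC CE] := @completed_algebra_genP (f @^-1` closure W);
    last by exists C.
  apply: mf; rewrite -[closure W]setCK -setTD.
  apply: sigma_algebraCD; apply: sub_sigma_algebra.
  by apply: closed_openC; exact: closed_closure.
have mtr (D : set (borelType G)) (s : G) : measurable D ->
    measurable [set w : borelType G | D ((w : G) * s)%g].
  move=> mD; rewrite -[X in measurable X]setTI.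
  have ch : continuous (fun w : G => w * s)%g.
    by apply: continuous_mulg_comp => w; [exact: cvg_id|exact: cvg_cst].
  exact: (continuous_borel_measurable ch).
(* For almost every w in A U W the path xi w maps U into closure W, so the set
   B U W below contains j @` U; unlike j @` U, it is measurable. *)
pose A (U : set I) (W : set X) : set (borelType G) :=
  ~` \bigcup_(U' in [set U' | BI U' /\ U (d U')])
    [set w : borelType G | (~` Q W) ((w : G) * j (d U'))%g].
have mA U W : BX W -> measurable (A U W).
  move=> /BXo/QP[mQ _]; apply: measurableC.
  apply: bigcup_countable_measurable => [|U' _]; last first.
    exact: mtr (measurableC mQ).
  by apply: sub_countable cBI; apply: subset_card_le => U' [].
pose E U W : set (borelType G * borelType G) :=
  [set p | A U W p.1 /\ ~ C W ((p.1 : G) * p.2)%g].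
have mE U W : BX W -> measurable (E U W).
  move=> BW; apply: measurableI.
    rewrite -[X in measurable X]setTI.
    exact: (@measurable_fst _ _ (borelType G) (borelType G) measurableT _
      (mA U W BW)).
  have ch : continuous (fun p : G * G => p.1 * p.2)%g.
    by apply: continuous_mulg_comp => p; [exact: cvg_fst|exact: cvg_snd].
  rewrite -[X in measurable X]setTI.
  exact: (continuous_borel_measurable2 scG scG ch measurableT
    (measurableC (CP W).1)).
(* Expressing the quantifier over almost every w by a section of measure zero is what makes [B U W]
   measurable. *)
pose B U W : set (borelType G) := (P \o ysection (E U W)) @^-1` [set 0].
have mB U W : BX W -> measurable (B U W).
  move=> BW; rewrite -[X in measurable X]setTI.
  exact: (measurable_fun_ysection P (mE U W BW) measurableT).
have BP U W s : BX W -> B U W s <->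
    {ae mu, forall w : borelType G, A U W w -> C W ((w : G) * s)%g}.
  move=> BW; rewrite /B /= -negligibleP;
    last exact: measurable_ysection (mE U W BW).
  have -> : ysection (E U W) s =
      ~` [set w : borelType G | A U W w -> C W ((w : G) * s)%g].
    apply/seteqP; split=> w; rewrite /ysection /= inE; last by move/not_implyP.
    by move=> [Aw nC] /(_ Aw).
  by split=> /null_dominates_ae; apply.
(* Apart from continuity of the path, only countably many conditions are imposed, so they hold
   simultaneously almost everywhere. *)
pose good (w : borelType G) := [/\ continuous (xi w),
  forall U, BI U -> xi w (d U) = f (w * j (d U))%g &
  forall UW, (BI `*` BX) UW ->
    (UW.2 (f (w * j (d UW.1))%g) <-> Q UW.2 (w * j (d UW.1))%g)].
have aegood : {ae mu, forall w, good w}.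
  have H1 : {ae mu, forall w : borelType G,
      forall U, BI U -> xi w (d U) = f (w * j (d U))%g}.
    by apply: ae_countable cBI _ => U _; exact: xif.
  have H2 : {ae mu, forall w : borelType G, forall UW, (BI `*` BX) UW ->
      (UW.2 (f (w * j (d UW.1))%g) <-> Q UW.2 (w * j (d UW.1))%g)}.
    apply: ae_countable (countableX cBI cBX) _ => -[U W] [_ /BXo/QP[_ QW]].
    exact: (ae_mulgr (j (d U)) QW).
  by apply: filterS3 cxi H1 H2 => w ? ? ?; split.
have UB U W i : BI U -> BX W -> U i -> B U W (j i).
  move=> BU BW Ui; apply/BP => //; have [_ CW] := CP W.
  apply: filterS3 aegood (xif i) (ae_mulgr (j i) CW) => w [cw wd wQ] wi wC Aw.
  apply/wC; rewrite -wi => O nO.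
  (* Continuity brings a sample point [d U'] of U into O; membership of w in [A U W] puts the path's
     value there in W, so [xi w i] is in the closure of W. *)
  have /BIb[U' [BU' U'i] U'O] : nbhs i (U `&` xi w @^-1` O).
    apply: filterI; last exact: cw.
    by apply: open_nbhs_nbhs; split => //; exact: BIo.
  have U'd : U' (d U') by apply: dU; exists i.
  have [Ud Od] := U'O _ U'd.
  exists (xi w (d U')); split => //; rewrite wd//; apply/(wQ (U', W)) => //=.
  by apply: contrapT => nQ; apply: Aw; exists U'.
pose O U W := [set y : G | ~ mu.-negligible
    (A U W `&` [set w : borelType G | B U W ((w : G)^-1 * y)%g])].
(* For x outside [O U W] the set of w satisfying the premises is null by definition, so countably
   many null sets of w are discarded. *)
have aex : {ae mu, forall w : borelType G, forall UW, (BI `*` BX) UW ->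
    A UW.1 UW.2 w -> B UW.1 UW.2 (w^-1 * x)%g -> O UW.1 UW.2 x}.
  apply: ae_countable (countableX cBI cBX) _ => -[U W] _ /=.
  have [nO|nnO] := pselect (mu.-negligible
      (A U W `&` [set w : borelType G | B U W ((w : G)^-1 * x)%g])).
    refine (negligibleS _ nO) => w /= /not_implyP[Aw /not_implyP[Bw _]].
    by split.
  by apply: aeW => w _ _.
(* This is the factorization x = w (j i). If no such w existed, w^-1 x would miss the range of [j]
   for almost every w; undoing the inversion and right translation would make that range null. *)
have [w [[cw wd wQ] wO] [i _ iw]] : exists2 w : G, good w /\
    (forall UW, (BI `*` BX) UW ->
    A UW.1 UW.2 w -> B UW.1 UW.2 (w^-1 * x)%g -> O UW.1 UW.2 x) &
    range j (w^-1 * x)%g.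
  apply: contrapT => now; apply: nj.
  have : {ae mu, forall w : borelType G, ~ range j ((w : G)^-1 * x)%g}.
    by apply: filterS2 aegood aex => w gw Ow jw; apply: now; exists w.
  move=> /ae_invg /(ae_mulgr x^-1%g).
  by apply: negligibleS => y jy; apply; rewrite invgK mulgVK.
exists (xi w i) => O1 /rX[N nN clN].
have [W [BW Wy] WN] := BXb _ _ nN.
have /BIb[U [BU Ui] UW] : nbhs i (xi w @^-1` W).
  by apply: cw; apply: open_nbhs_nbhs; split => //; exact: BXo.
exists (O U W).
  apply: open_nbhs_nbhs; split.
    exact: (open_nonnull_translate (mA _ _ BW) (mB _ _ BW)).
  (* The path of w sends U into W, so w is in [A U W], and w^-1 x = j i is in [B U W]; hence x is in
     [O U W]. *)
  apply: (wO (U, W)) => //=; last by rewrite -iw; exact: UB.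
  move=> [U' [BU' /UW Wd]]; apply; apply/(wQ (U', W)) => //=.
  by rewrite -wd.
have [mC CW] := CP W.
have BC s : B U W s ->
    {ae mu, forall w : borelType G, A U W w -> C W ((w : G) * s)%g}.
  by move/BP; apply.
have := ae_of_translates (mA _ _ BW) (mB _ _ BW) mC BC.
apply: filterS2 CW => z CWz OC /OC /CWz; move=> clW; apply: clN.
exact: closureS clW.
Qed.

End haar_measure.

(** * The alternative *)

Lemma non_null_not_negligible (R : realType) (G : topologicalGroupType)
    (mu : {measure set (borelType G) -> \bar R}) (T : set G) :
  non_null mu T -> ~ mu.-negligible (T : set (borelType G)).
Proof.
rewrite /non_null ltNge => /negP T0 [A [mA A0 TA]]; apply: T0.
rewrite -A0 -(measurable_mu_extE mu mA).
by apply: le_mu_ext.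
Qed.

Theorem theorem10 (R : realType) (G : topologicalGroupType)
    (mu : {measure set (borelType G) -> \bar R}) (X : topologicalType)
    (f : G -> X) (P : probability (borelType G) R) :
  polish R G -> locally_compact [set: G] ->
  left_haar_measure mu ->
  separable X -> metrizable R X ->
  haar_measurable_fun mu f ->
  P `<< mu /\ mu `<< P ->
  sample_continuous P (translation_field f) \/
  (forall T : set G, non_null mu T ->
     ~ exists xi : borelType G -> T -> X,
         natural_modification P (restrict_field (translation_field f) (T := T)) xi).
Proof.
move=> [sepG [MG [_ hMG]]] lcG [muR muL mu0] sepX mX mf [P_mu mu_P].
have scG : @second_countable G.
  by apply: separable_metrizable_second_countable sepG _; exists MG.
have hG := homeomorphic_hausdorff hMG (@metric_hausdorff _ MG).
have scX := separable_metrizable_second_countable sepX mX.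
have [MX hMX] := mX.
have hX := homeomorphic_hausdorff hMX (@metric_hausdorff _ MX).
have rX := homeomorphic_regular hMX (@uniform_regular MX).
have [natT|] := pselect (exists2 T : set G, non_null mu T &
    exists xi : borelType G -> T -> X,
      natural_modification P (restrict_field (translation_field f) (T := T)) xi);
  last by move=> noT; right => T nT nat; apply: noT; exists T.
left; have [T nT [xi [xif [tau [sctau cxi]]]]] := natT.
have muae (Q : borelType G -> Prop) := @null_dominates_ae _ _ _ mu P Q mu_P.
pose I := Topological.Pack tau.
pose j (i : I) : G := set_val (i : T).
have rj : ~ mu.-negligible (range j : set (borelType G)).
  move=> nj; apply: (non_null_not_negligible nT).
  by apply: negligibleS nj => x Tx; exists (SigSub (mem_set Tx)).
have lim := essential_limit scG muL P_mu mu_P hG lcG muR sctau scX rX mf rj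
  (fun i => muae _ (xif i)) (muae _ cxi).
have [g cg gf] := continuous_ae_representative scG muL mu0 scX hX rX lim.
(* For fixed t, right translation by t preserves the null set where g and f differ; every path is
   continuous because g is. *)
exists (fun w t => g ((w : G) * t)%g).
  move=> t; apply: (null_dominates_ae P_mu).
  exact: (ae_mulgr scG muL P_mu mu_P t gf).
apply: aeW => w x; apply: (@continuous_comp _ _ _ (fun t : G => w * t)%g g).
  have cw : continuous (fun t : G => w * t)%g.
    by apply: continuous_mulg_comp => t; [exact: cvg_cst|exact: cvg_id].
  exact: cw.
exact: cg.
Qed.
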